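(* Let $p,q$ be nonnegative integers, let $\kappa_1,\dots,\kappa_p,\mu_1,\dots,\mu_q$ be complex numbers none of which is in $\{0,-1,-2,\dots\}$, let $\alpha,\beta\in\mathbb{C}$ with $\Re(\alpha)>0$, and let $x,y,\rho\in\mathbb{C}$ with $\Re(x)>0$, $\Re(y)>0$, $\Re(\rho)>0$. Then the M-beta function has the integral representations $${}^{M}B_{p,q}^{(\alpha,\beta)}(x,y;\rho)=2\int_{0}^{\frac{\pi}{2}} \cos^{2x-1}(\theta) \sin^{2y-1}(\theta)\;{}_{p}^{\alpha}M^{\beta}_{q}\left(\kappa_{1},\ldots,\kappa_{p};\mu_{1},\ldots,\mu_{q};\frac{-\rho}{\sin^{2}(\theta)\cos^{2}(\theta)}\right)d\theta$$ and $${}^{M}B_{p,q}^{(\alpha,\beta)}(x,y;\rho)=\int_{0}^{\infty}\frac{u^{x-1}}{(1+u)^{x+y}}\;{}_{p}^{\alpha}M^{\beta}_{q}\left(\kappa_{1},\ldots,\kappa_{p};\mu_{1},\ldots,\mu_{q};-2\rho-\rho\left( u+\frac{1}{u}\right)\right)du.$$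
   Context: $(\lambda)_m=\Gamma(\lambda+m)/\Gamma(\lambda)$, $(\lambda)_0=1$ is the Pochhammer symbol. The generalized M-series is $${}_{p}^{\alpha}M^{\beta}_{q}(\kappa_{1},\ldots,\kappa_{p};\mu_{1},\ldots,\mu_{q};z)=\sum_{m=0}^{\infty}\frac{(\kappa_{1})_{m}\cdots(\kappa_p)_{m}}{(\mu_1)_{m}\cdots(\mu_q)_{m}}\frac{z^{m}}{\Gamma(\alpha m+\beta)}.$$ The modified beta (M-beta) function, with parameters $\kappa_1,\dots,\kappa_p;\mu_1,\dots,\mu_q$ suppressed from the notation, is $${}^{M}B_{p,q}^{(\alpha,\beta)}(x,y;\rho)=\int_{0}^{1}t^{x-1}(1-t)^{y-1}\,{}_{p}^{\alpha}M^{\beta}_{q}\left(\kappa_{1},\ldots,\kappa_{p};\mu_{1},\ldots,\mu_{q};\frac{-\rho}{t(1-t)}\right) dt.$$ These functions are defined for those parameters and arguments for which the series and integrals converge. *)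

(* Defs.v *)
From Stdlib Require Import Reals Lra Lia List.
From Coquelicot Require Export Coquelicot.

Open Scope C_scope.

Definition Cexp (z : C) : C :=
  RtoC (exp (Re z)) * (cos (Im z), sin (Im z)).

(** Principal power of a positive real base, [t ^ z = e ^ (z ln t)]; for
    [t <= 0] the value is meaningless and is not used. *)
Definition Rcpow (t : R) (z : C) : C := Cexp (z * RtoC (ln t)).

(** Improper Riemann integrals of complex-valued functions of a real variable.
    The ends [a], [b] are filters and are approached independently. *)
Definition ex_CRInt_gen (f : R -> C) (a b : (R -> Prop) -> Prop) : Prop :=
  @ex_RInt_gen C_R_NormedModule f a b.

Definition CRInt_gen (f : R -> C) (a b : (R -> Prop) -> Prop) : C :=
  @RInt_gen C_R_CompleteNormedModule f a b.

Definition ex_CSeries (a : nat -> C) : Prop := @ex_series C_AbsRing C_NormedModule a.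

Definition CSeries (a : nat -> C) : C :=
  @iota (CompleteNormedModule.CompleteSpace C_AbsRing C_CompleteNormedModule)
    (@is_series C_AbsRing C_NormedModule a).

Definition Gamma_int (z : C) : C :=
  CRInt_gen (fun t => Rcpow t (z - 1) * RtoC (exp (- t)))
    (at_right 0) (Rbar_locally p_infty).

Fixpoint rising (z : C) (n : nat) : C :=
  match n with
  | O => 1
  | S k => rising z k * (z + RtoC (INR k))
  end.

(** The number of unit steps to the right that bring [z] into [Re > 0];
    it is [0] if already [0 < Re z]. *)
Definition Gamma_shift (z : C) : nat := Z.to_nat (up (- Re z)).

(** Euler's integral, continued by
    [Gamma z = Gamma (z + n) / (z (z + 1) ... (z + n - 1))].
    At a pole the denominator is [0], so that division by zero gives
    [Gamma z = 0] and [/ Gamma z = 0]: the latter is the value there of the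
    entire function 1/Gamma (see [inv_Gamma_pole]). *)
Definition Gamma (z : C) : C :=
  Gamma_int (z + RtoC (INR (Gamma_shift z))) / rising z (Gamma_shift z).

Definition nonpos_int (z : C) : Prop := exists n : nat, z = RtoC (- INR n).

Definition poch (l : C) (m : nat) : C :=
  match m with
  | O => 1
  | S _ => Gamma (l + RtoC (INR m)) / Gamma l
  end.

Definition poch_prod (ls : list C) (m : nat) : C :=
  fold_right Cmult 1 (map (fun l => poch l m) ls).

(** [p] and [q] are the lengths of [kappa] and [mu]. *)
Definition M_term (kappa mu : list C) (alpha beta z : C) (m : nat) : C :=
  poch_prod kappa m / poch_prod mu m
  * (z ^ m / Gamma (alpha * RtoC (INR m) + beta)).

Definition M_series (kappa mu : list C) (alpha beta z : C) : C :=
  CSeries (M_term kappa mu alpha beta z).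

Definition M_beta_arg (rho : C) (t : R) : C := - rho / RtoC (t * (1 - t)).

Definition M_beta_integrand (kappa mu : list C) (alpha beta x y rho : C) (t : R) : C :=
  Rcpow t (x - 1) * Rcpow (1 - t) (y - 1)
  * M_series kappa mu alpha beta (M_beta_arg rho t).

Definition M_beta (kappa mu : list C) (alpha beta x y rho : C) : C :=
  CRInt_gen (M_beta_integrand kappa mu alpha beta x y rho) (at_right 0) (at_left 1).

Definition M_beta_converges (kappa mu : list C) (alpha beta x y rho : C) : Prop :=
  (forall t : R, (0 < t < 1)%R ->
     ex_CSeries (M_term kappa mu alpha beta (M_beta_arg rho t))) /\
  ex_CRInt_gen (M_beta_integrand kappa mu alpha beta x y rho) (at_right 0) (at_left 1).

Lemma Gamma_shift_pos (z : C) : (0 < Re z)%R -> Gamma_shift z = O.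
Proof.
  intros Hz. unfold Gamma_shift.
  destruct (archimed (- Re z)) as [_ H].
  assert (Hlt : (IZR (up (- Re z)) < 1)%R) by lra.
  apply lt_IZR in Hlt. lia.
Qed.

Lemma inv_Gamma_pole (z : C) : nonpos_int z -> / Gamma z = 0.
Proof.
  intros [n ->].
  assert (Hs : Gamma_shift (RtoC (- INR n)) = S n).
  { unfold Gamma_shift; simpl; rewrite Ropp_involutive, INR_IZR_INZ.
    rewrite <- (tech_up (IZR (Z.of_nat n)) (Z.of_nat n + 1));
      [lia | rewrite plus_IZR; lra | rewrite plus_IZR; lra]. }
  assert (Hi : / (0 : C) = 0).
  { unfold Cinv, RtoC; simpl; f_equal; unfold Rdiv; ring. }
  unfold Gamma; rewrite Hs; cbn [rising].
  replace (RtoC (- INR n) + RtoC (INR n)) with (RtoC 0).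
  2: { rewrite <- RtoC_plus; f_equal; ring. }
  unfold Cdiv; rewrite Cmult_0_r, Hi, Cmult_0_r; exact Hi.
Qed.

(* Main.v *)
(** The two representations are the substitutions [t = cos^2 theta] and
    [t = u / (1 + u)] in the improper integral over (0, 1).  Substitution needs
    the integrand to be continuous.  The arguments of the M-series are
    [- rho * s] with [s = 1 / (t (1 - t))] running over [4, oo), so convergence
    there makes the real and imaginary parts of the series, as real power
    series in [s], converge on the whole line, hence be continuous. *)

Require Import Defs.
From Stdlib Require Import Reals Lra List FunctionalExtensionality.
From Coquelicot Require Import Coquelicot.

Open Scope C_scope.

(** * Change of variables in improper integrals *)

(** Proper substitution applies on each segment whose ends are close to [Ga] and [Gb]; the limits of
    [g] then bring the image ends close to [Fa] and [Fb]. The order-convex set [c] keeps the whole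
    segment where [f] is continuous along [g] and [g] is continuously differentiable. Only the
    matching of ends matters, so [g] may be decreasing. *)
Lemma is_RInt_gen_comp {V : CompleteNormedModule R_AbsRing}
    (Fa Fb Ga Gb : (R -> Prop) -> Prop) {FGa : Filter Ga} {FGb : Filter Gb}
    (f : R -> V) (g dg : R -> R) (c : R -> Prop) (l : V) :
  (forall x y z, c x -> c y -> Rmin x y <= z <= Rmax x y -> c z)%R ->
  (forall x, c x -> continuous f (g x)) ->
  (forall x, c x -> is_derive g x (dg x) /\ continuous dg x) ->
  Ga c -> Gb c -> filterlim g Ga Fa -> filterlim g Gb Fb ->
  is_RInt_gen f Fa Fb l ->
  is_RInt_gen (fun y => scal (dg y) (f (g y))) Ga Gb l.
Proof.
  intros Hc Hf Hg Ha Hb La Lb HI P HP.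
  destruct (HI P HP) as [Q1 Q2 HQ1 HQ2 H].
  apply Filter_prod with (fun x => c x /\ Q1 (g x)) (fun x => c x /\ Q2 (g x)).
  - apply filter_and; [exact Ha | exact (La _ HQ1)].
  - apply filter_and; [exact Hb | exact (Lb _ HQ2)].
  - intros a b [Hca Hqa] [Hcb Hqb].
    destruct (H _ _ Hqa Hqb) as [v [Hv Pv]]; simpl in Hv.
    exists v; split; [|exact Pv]; simpl.
    (* [is_RInt_comp] yields the value [RInt f (g a) (g b)], so [v] is put in that form. *)
    rewrite <- (is_RInt_unique _ _ _ _ Hv).
    apply is_RInt_comp; intros z Hz; [apply Hf | apply Hg]; exact (Hc _ _ _ Hca Hcb Hz).
Qed.

(** One-sided filters are [within] filters: a two-sided limit becomes one-sided once the values
    eventually stay on the right side of it. *)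
Lemma filterlim_within {T : Type} {U : UniformSpace} (F : (T -> Prop) -> Prop)
    {FF : Filter F} (f : T -> U) (D : U -> Prop) (l : U) :
  filterlim f F (locally l) -> F (fun x => D (f x)) ->
  filterlim f F (within D (locally l)).
Proof.
  intros Hf HD P HP.
  generalize (filter_and _ _ (Hf _ HP) HD); unfold filtermap.
  apply filter_imp; intros x [H1 H2]; auto.
Qed.

(** * Continuity of complex-valued maps through real and imaginary parts *)

(** A ball of [C] is a product of balls of the two parts, so one radius serves both. *)
Lemma continuous_C {U : UniformSpace} (h : U -> C) (x : U) :
  continuous (fun t => Re (h t)) x -> continuous (fun t => Im (h t)) x ->
  continuous h x.
Proof.
  intros H1 H2 P [eps HP].
  assert (B1 : locally x (fun t => ball (Re (h x)) eps (Re (h t))))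
    by exact (H1 _ (locally_ball (Re (h x)) eps)).
  assert (B2 : locally x (fun t => ball (Im (h x)) eps (Im (h t))))
    by exact (H2 _ (locally_ball (Im (h x)) eps)).
  refine (filter_imp _ _ _ (filter_and _ _ B1 B2)).
  intros t [C1 C2]; apply HP; split; assumption.
Qed.

Lemma continuous_Re {U : UniformSpace} (h : U -> C) (x : U) :
  continuous h x -> continuous (fun t => Re (h t)) x.
Proof.
  intros H; apply (continuous_comp h fst); [exact H|].
  rewrite (surjective_pairing (h x)); apply continuous_fst.
Qed.

Lemma continuous_Im {U : UniformSpace} (h : U -> C) (x : U) :
  continuous h x -> continuous (fun t => Im (h t)) x.
Proof.
  intros H; apply (continuous_comp h snd); [exact H|].
  rewrite (surjective_pairing (h x)); apply continuous_snd.
Qed.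

Lemma continuous_Cmult {U : UniformSpace} (f g : U -> C) (x : U) :
  continuous f x -> continuous g x -> continuous (fun t => f t * g t) x.
Proof.
  intros Hf Hg.
  pose proof (continuous_Re _ _ Hf) as H1; pose proof (continuous_Im _ _ Hf) as H2.
  pose proof (continuous_Re _ _ Hg) as H3; pose proof (continuous_Im _ _ Hg) as H4.
  apply continuous_C.
  - exact (continuous_minus (V := R_NormedModule) _ _ x
      (continuous_mult (K := R_AbsRing) _ _ x H1 H3)
      (continuous_mult (K := R_AbsRing) _ _ x H2 H4)).
  - exact (continuous_plus (V := R_NormedModule) _ _ x
      (continuous_mult (K := R_AbsRing) _ _ x H1 H4)
      (continuous_mult (K := R_AbsRing) _ _ x H2 H3)).
Qed.

(** * Complex exponential and powers of a positive base *)

Lemma Cexp_plus (z w : C) : Cexp (z + w) = Cexp z * Cexp w.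
Proof.
  destruct z as [a b], w as [c d]; unfold Cexp; simpl.
  rewrite exp_plus, cos_plus, sin_plus.
  unfold RtoC, Cmult; simpl; f_equal; ring.
Qed.

Lemma Cexp_RtoC (r : R) : Cexp (RtoC r) = RtoC (exp r).
Proof.
  unfold Cexp; simpl; rewrite cos_0, sin_0.
  unfold RtoC, Cmult; simpl; f_equal; ring.
Qed.

Lemma Cexp_opp_l (z : C) : Cexp (- z) * Cexp z = 1.
Proof.
  rewrite <- Cexp_plus, Cplus_comm, Cplus_opp_r, Cexp_RtoC, exp_0; reflexivity.
Qed.

Lemma Cexp_neq_0 (z : C) : Cexp z <> 0.
Proof.
  intros H; generalize (Cexp_opp_l z); rewrite H, Cmult_0_r.
  intros E; apply (f_equal fst) in E; simpl in E; lra.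
Qed.

Lemma Cexp_opp (z : C) : Cexp (- z) = / Cexp z.
Proof.
  rewrite <- (Cmult_1_r (Cexp (- z))), <- (Cinv_r (Cexp z)) by apply Cexp_neq_0.
  rewrite Cmult_assoc, Cexp_opp_l; ring.
Qed.

Lemma Rcpow_plus (t : R) (z w : C) : Rcpow t (z + w) = Rcpow t z * Rcpow t w.
Proof.
  unfold Rcpow; rewrite <- Cexp_plus; f_equal; ring.
Qed.

Lemma Rcpow_1 (t : R) : (0 < t)%R -> Rcpow t 1 = RtoC t.
Proof.
  intros Ht; unfold Rcpow; rewrite Cmult_1_l, Cexp_RtoC, exp_ln; auto.
Qed.

Lemma Rcpow_mult (s t : R) (z : C) :
  (0 < s)%R -> (0 < t)%R -> Rcpow (s * t) z = Rcpow s z * Rcpow t z.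
Proof.
  intros Hs Ht; unfold Rcpow.
  rewrite ln_mult, RtoC_plus, <- Cexp_plus by assumption; f_equal; ring.
Qed.

Lemma Rcpow_Rinv (t : R) (z : C) : (0 < t)%R -> Rcpow (/ t) z = / Rcpow t z.
Proof.
  intros Ht; unfold Rcpow.
  rewrite ln_Rinv, RtoC_opp, <- Cexp_opp by assumption; f_equal; ring.
Qed.

Lemma Rcpow_neq_0 (t : R) (z : C) : Rcpow t z <> 0.
Proof. apply Cexp_neq_0. Qed.

Lemma continuous_Rcpow (t : R) (z : C) :
  (0 < t)%R -> continuous (fun s => Rcpow s z) t.
Proof.
  intros Ht; apply continuous_C; unfold Rcpow, Cexp; simpl;
    apply (ex_derive_continuous (V := R_NormedModule)); auto_derive; auto.
Qed.

(** * Complex series and power series along a ray *)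

(** [Re] commutes with partial sums and is continuous, so it passes to the limit. *)
Lemma is_series_Re (a : nat -> C) (l : C) :
  @is_series C_AbsRing C_NormedModule a l ->
  is_series (fun n => Re (a n)) (Re l).
Proof.
  intros H; unfold is_series.
  apply filterlim_ext with (fun n => Re (@sum_n C_NormedModule a n)).
  - induction x as [|n IH]; [now rewrite !sum_O|].
    rewrite !sum_Sn, <- IH; reflexivity.
  - apply (filterlim_comp _ _ _ _ Re _ _ _ H).
    rewrite (surjective_pairing l) at 1; apply continuous_fst.
Qed.

Lemma is_series_Im (a : nat -> C) (l : C) :
  @is_series C_AbsRing C_NormedModule a l ->
  is_series (fun n => Im (a n)) (Im l).
Proof.
  intros H; unfold is_series.
  apply filterlim_ext with (fun n => Im (@sum_n C_NormedModule a n)).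
  - induction x as [|n IH]; [now rewrite !sum_O|].
    rewrite !sum_Sn, <- IH; reflexivity.
  - apply (filterlim_comp _ _ _ _ Im _ _ _ H).
    rewrite (surjective_pairing l) at 1; apply continuous_snd.
Qed.

(** [CSeries] is chosen by [iota]; uniqueness of limits forces the choice to be the sum as soon as
    one exists. *)
Lemma CSeries_correct (a : nat -> C) :
  ex_CSeries a -> @is_series C_AbsRing C_NormedModule a (CSeries a).
Proof.
  intros [l Hl].
  assert (E : CSeries a = l).
  { exact (iota_filterlim_locally (K := C_AbsRing) (V := C_CompleteNormedModule)
      (F := eventually) (@sum_n C_NormedModule a) l Hl). }
  rewrite E; exact Hl.
Qed.

Lemma CSeries_ext (a b : nat -> C) : (forall n, a n = b n) -> CSeries a = CSeries b.
Proof.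
  intros E; replace b with a; [reflexivity | apply functional_extensionality, E].
Qed.

(** Convergence at arbitrarily large points forces an infinite radius: outside the disk the terms
    cannot tend to zero. *)
Lemma ex_pseries_lt_CV_radius (a : nat -> R) (r x : R) :
  (forall s, r <= s -> ex_pseries a s)%R -> Rbar_lt (Rabs x) (CV_radius a).
Proof.
  intros H.
  (* Being at least [r], [s] is a point of convergence; the added [1] puts it strictly beyond
     [Rabs x]. *)
  set (s := Rmax r (Rabs x + 1)).
  assert (Hs : (Rabs x < s)%R) by (unfold s; generalize (Rmax_r r (Rabs x + 1)); lra).
  apply Rbar_lt_le_trans with (Finite (Rabs s)).
  - simpl; generalize (Rle_abs s); lra.
  - apply Rbar_not_lt_le; intros Hlt; apply (CV_disk_outside _ _ Hlt).
    apply (ex_series_lim_0 (fun n => a n * s ^ n)%R), ex_pseries_R, H, Rmax_l.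
Qed.

(* On a ray the real and imaginary parts are real power series, and these
   converge everywhere once they converge far out. *)
Lemma CSeries_ray_continuous (a : nat -> C) (r : R) :
  (forall s, (r <= s)%R -> ex_CSeries (fun n => a n * RtoC (s ^ n))) ->
  exists g : R -> C, (forall s, continuous g s) /\
    forall s, (r <= s)%R -> CSeries (fun n => a n * RtoC (s ^ n)) = g s.
Proof.
  intros H.
  assert (HRe : forall s, (r <= s)%R -> is_pseries (fun n => Re (a n)) s
      (Re (CSeries (fun n => a n * RtoC (s ^ n))))).
  { intros s Hs; apply is_pseries_R.
    eapply is_series_ext; [|exact (is_series_Re _ _ (CSeries_correct _ (H s Hs)))].
    intros n; simpl; unfold Re; ring. }
  assert (HIm : forall s, (r <= s)%R -> is_pseries (fun n => Im (a n)) s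
      (Im (CSeries (fun n => a n * RtoC (s ^ n))))).
  { intros s Hs; apply is_pseries_R.
    eapply is_series_ext; [|exact (is_series_Im _ _ (CSeries_correct _ (H s Hs)))].
    intros n; simpl; unfold Im; ring. }
  (* These power series agree with [CSeries] for [s >= r], and their infinite radius makes them
     continuous on the whole line, in particular on both sides of the end [r] of the ray. *)
  exists (fun s => (PSeries (fun n => Re (a n)) s, PSeries (fun n => Im (a n)) s)); split.
  - intros s; apply continuous_C; apply continuity_pt_filterlim, PSeries_continuity,
      (ex_pseries_lt_CV_radius _ r); intros s' Hs'.
    + exact (ex_intro _ _ (HRe s' Hs')).
    + exact (ex_intro _ _ (HIm s' Hs')).
  - intros s Hs.
    rewrite (is_pseries_unique _ _ _ (HRe s Hs)), (is_pseries_unique _ _ _ (HIm s Hs)).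
    apply surjective_pairing.
Qed.

(** * Continuity of the M-beta integrand on (0, 1) *)

(** Pulling out the real factor exhibits the M-series along the ray through [w] as a power series in
    [s]. *)
Lemma M_term_scale (kappa mu : list C) (alpha beta w : C) (s : R) (m : nat) :
  M_term kappa mu alpha beta (w * RtoC s) m =
  M_term kappa mu alpha beta w m * RtoC (s ^ m).
Proof.
  unfold M_term, Cdiv; rewrite Cpow_mult_l, RtoC_pow; ring.
Qed.

Lemma RtoC_neq_0 (r : R) : r <> 0%R -> RtoC r <> 0.
Proof. intros H E; apply H, RtoC_inj, E. Qed.

Lemma M_beta_arg_inv (rho : C) (t : R) :
  (0 < t < 1)%R -> M_beta_arg rho t = - rho * RtoC (/ (t * (1 - t))).
Proof.
  intros Ht; unfold M_beta_arg; rewrite RtoC_inv; [reflexivity|].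
  apply Rgt_not_eq, Rmult_lt_0_compat; lra.
Qed.

(** Transfers convergence from all [t] in (0, 1) to all [s >= 4]. The witness is the larger root of
    [t (1 - t) = 1 / s], and [w] is the square root of the discriminant [1 - 4 / s]. *)
Lemma inv_mult_1_minus_surj (s : R) :
  (4 <= s)%R -> exists t, (0 < t < 1)%R /\ (/ (t * (1 - t)))%R = s.
Proof.
  intros Hs.
  assert (Hi : (0 < / s)%R) by (apply Rinv_0_lt_compat; lra).
  assert (H4 : (4 * / s <= 1)%R).
  { apply Rmult_le_reg_r with s; [lra|]; field_simplify; lra. }
  set (w := sqrt (1 - 4 * / s)).
  assert (Hw : (w * w = 1 - 4 * / s)%R) by (apply sqrt_sqrt; lra).
  assert (Hw0 : (0 <= w)%R) by apply sqrt_pos.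
  assert (Hw1 : (w < 1)%R) by (apply Rnot_le_lt; intros L; nra).
  exists ((1 + w) / 2)%R; split; [lra|].
  replace ((1 + w) / 2 * (1 - (1 + w) / 2))%R with (/ s)%R; [apply Rinv_inv|].
  transitivity ((1 - w * w) / 4)%R; [rewrite Hw|]; field; lra.
Qed.

Lemma continuous_M_beta_integrand (kappa mu : list C) (alpha beta x y rho : C) :
  (forall t : R, (0 < t < 1)%R ->
     ex_CSeries (M_term kappa mu alpha beta (M_beta_arg rho t))) ->
  forall t : R, (0 < t < 1)%R ->
    continuous (M_beta_integrand kappa mu alpha beta x y rho) t.
Proof.
  intros H t Ht.
  (* The ray starts at [4], the minimum of [1 / (t (1 - t))], attained at [t = 1/2]. *)
  destruct (CSeries_ray_continuous (M_term kappa mu alpha beta (- rho)) 4)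
    as [g [Hg Eg]].
  { intros s Hs; destruct (inv_mult_1_minus_surj s Hs) as [t' [Ht' <-]].
    destruct (H t' Ht') as [l Hl]; exists l.
    eapply is_series_ext; [|exact Hl].
    intros n; rewrite (M_beta_arg_inv _ _ Ht'); apply M_term_scale. }
  unfold M_beta_integrand; apply continuous_Cmult; [apply continuous_Cmult|].
  - apply continuous_Rcpow; lra.
  - apply (continuous_comp (fun s => 1 - s)%R (fun s => Rcpow s (y - 1))).
    + apply (ex_derive_continuous (V := R_NormedModule)); auto_derive; auto.
    + apply continuous_Rcpow; lra.
  (* The M-series is known to equal [g (1 / (s (1 - s)))] only inside (0, 1), hence a local
     replacement. *)
  - apply (continuous_ext_loc _ (fun s => g (/ (s * (1 - s)))%R)).
    + apply (filter_imp (fun s => 0 < s < 1)%R); [|apply (locally_interval _ t 0 1);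
        simpl; [lra|lra|auto]].
      intros s Hs; unfold M_series; rewrite <- Eg.
      * apply CSeries_ext; intros n; rewrite (M_beta_arg_inv _ _ Hs).
        symmetry; apply M_term_scale.
      (* After clearing the denominator, the bound by [4] amounts to [(2 s - 1)^2 >= 0]. *)
      * apply Rmult_le_reg_l with (s * (1 - s))%R; [nra|].
        rewrite Rinv_r by nra; assert (0 <= (2 * s - 1) ^ 2)%R by apply pow2_ge_0; lra.
    + apply (continuous_comp (fun s => / (s * (1 - s)))%R g); [|apply Hg].
      apply (ex_derive_continuous (V := R_NormedModule)); auto_derive; nra.
Qed.

(** * Real scalars and one-sided neighbourhoods *)

Lemma scal_C_R (r : R) (z : C) : @scal R_AbsRing C_R_NormedModule r z = RtoC r * z.
Proof.
  destruct z as [a b].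
  change ((r * a, r * b)%R = RtoC r * (a, b)); unfold RtoC, Cmult; simpl; f_equal; ring.
Qed.

Lemma continuous_at_left (f : R -> R) (a : R) :
  continuous f a -> filterlim f (at_left a) (locally (f a)).
Proof. intros H; apply filterlim_filter_le_1 with (2 := H); apply filter_le_within. Qed.

Lemma continuous_at_right (f : R -> R) (a : R) :
  continuous f a -> filterlim f (at_right a) (locally (f a)).
Proof. intros H; apply filterlim_filter_le_1 with (2 := H); apply filter_le_within. Qed.

Lemma at_right_lt (a b : R) : (a < b)%R -> at_right a (fun x => a < x < b)%R.
Proof.
  intros H; unfold at_right, within; apply (filter_imp (fun x => x < b)%R); [auto|].
  apply (open_lt b a H).
Qed.

Lemma at_left_gt (a b : R) : (a < b)%R -> at_left b (fun x => a < x < b)%R.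
Proof.
  intros H; unfold at_left, within; apply (filter_imp (fun x => a < x)%R); [auto|].
  apply (open_gt a b H).
Qed.

(** * The integrand after each substitution *)

(** Squaring the base doubles the exponent [x - 1], and the factor [cos theta] of the Jacobian
    raises it to [2 x - 1]; likewise for [sin theta] and [y]. The constant [-2] of the Jacobian is
    left out here. *)
Lemma M_beta_integrand_cos2 (kappa mu : list C) (alpha beta x y rho : C) (theta : R) :
  (0 < cos theta)%R -> (0 < sin theta)%R ->
  RtoC (cos theta * sin theta) *
    M_beta_integrand kappa mu alpha beta x y rho (cos theta ^ 2) =
  Rcpow (cos theta) (2 * x - 1) * Rcpow (sin theta) (2 * y - 1)
  * M_series kappa mu alpha beta
      (- rho / RtoC ((sin theta) ^ 2 * (cos theta) ^ 2)%R).
Proof.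
  intros Hc Hs.
  assert (E : (1 - cos theta ^ 2 = sin theta ^ 2)%R).
  { generalize (sin2_cos2 theta); unfold Rsqr; simpl; lra. }
  unfold M_beta_integrand, M_beta_arg; rewrite E, (Rmult_comm (cos theta ^ 2)).
  replace (cos theta ^ 2)%R with (cos theta * cos theta)%R at 1 by ring.
  replace (sin theta ^ 2)%R with (sin theta * sin theta)%R at 1 by ring.
  rewrite !Rcpow_mult by assumption.
  replace (2 * x - 1) with ((x - 1) + (x - 1) + 1) by ring.
  replace (2 * y - 1) with ((y - 1) + (y - 1) + 1) by ring.
  rewrite !Rcpow_plus, !Rcpow_1, RtoC_mult by assumption; ring.
Qed.

(** With [t = u / (1 + u)] one has [1 - t = 1 / (1 + u)], whence [1 / (t (1 - t)) = (1 + u)^2 / u =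
    2 + u + 1 / u]. The exponents [x - 1] and [y - 1] and the Jacobian's [2] add up to [x + y] on
    [1 + u]. *)
Lemma M_beta_integrand_ratio (kappa mu : list C) (alpha beta x y rho : C) (u : R) :
  (0 < u)%R ->
  RtoC (/ (1 + u) ^ 2) *
    M_beta_integrand kappa mu alpha beta x y rho (u / (1 + u)) =
  Rcpow u (x - 1) / Rcpow (1 + u) (x + y)
  * M_series kappa mu alpha beta (- (2 * rho) - rho * RtoC (u + 1 / u)%R).
Proof.
  intros Hu.
  assert (E : (1 - u / (1 + u) = / (1 + u))%R) by (field; lra).
  unfold M_beta_integrand, M_beta_arg; rewrite E.
  replace (- rho / RtoC (u / (1 + u) * / (1 + u)))
    with (- (2 * rho) - rho * RtoC (u + 1 / u)).
  2: { unfold Cdiv; rewrite <- RtoC_inv.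
    - replace (/ (u / (1 + u) * / (1 + u)))%R with (2 + (u + 1 / u))%R by (field; lra).
      rewrite (RtoC_plus 2); ring.
    - apply Rgt_not_eq; unfold Rdiv; repeat apply Rmult_lt_0_compat;
        try apply Rinv_0_lt_compat; lra. }
  unfold Rdiv at 1; rewrite Rcpow_mult by (try apply Rinv_0_lt_compat; lra).
  rewrite !Rcpow_Rinv by lra.
  replace (x + y) with ((x - 1) + (y - 1) + 1 + 1) by ring.
  rewrite !(Rcpow_plus (1 + u) _ 1), (Rcpow_plus (1 + u) (x - 1)), Rcpow_1 by lra.
  rewrite RtoC_inv by (apply pow_nonzero; lra).
  replace ((1 + u) ^ 2)%R with ((1 + u) * (1 + u))%R by ring.
  rewrite RtoC_mult; field; repeat split; try apply Rcpow_neq_0.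
  apply RtoC_neq_0; lra.
Qed.

Lemma cos_sin_pos (theta : R) :
  (0 < theta < PI / 2)%R -> (0 < cos theta < 1)%R /\ (0 < sin theta)%R.
Proof.
  intros Ht.
  assert (Hc : (0 < cos theta)%R) by (apply cos_gt_0; lra).
  assert (Hs : (0 < sin theta)%R) by (apply sin_gt_0; lra).
  generalize (sin2_cos2 theta); unfold Rsqr; intros E.
  repeat split; auto; nra.
Qed.

Lemma between_interval (a b x y z : R) :
  (a < x < b)%R -> (a < y < b)%R -> (Rmin x y <= z <= Rmax x y)%R -> (a < z < b)%R.
Proof.
  intros Hx Hy; unfold Rmin, Rmax; destruct (Rle_dec x y); lra.
Qed.

(** * The trigonometric and half-line representations *)

(** [CRInt_gen] assigns a value even to a divergent integral, so each equation is paired with the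
    convergence of its right-hand integral; [M_beta_converges] gives the left side its meaning. *)
Theorem theorem3p4 :
  forall (kappa mu : list C) (alpha beta x y rho : C),
    (forall k : C, In k kappa -> ~ nonpos_int k) ->
    (forall k : C, In k mu -> ~ nonpos_int k) ->
    (0 < Re alpha)%R ->
    (0 < Re x)%R -> (0 < Re y)%R -> (0 < Re rho)%R ->
    M_beta_converges kappa mu alpha beta x y rho ->
    let F := fun theta : R =>
      Rcpow (cos theta) (2 * x - 1) * Rcpow (sin theta) (2 * y - 1)
      * M_series kappa mu alpha beta
          (- rho / RtoC ((sin theta) ^ 2 * (cos theta) ^ 2)%R) in
    let G := fun u : R =>
      Rcpow u (x - 1) / Rcpow (1 + u) (x + y)
      * M_series kappa mu alpha beta
          (- (2 * rho) - rho * RtoC (u + 1 / u)%R) in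
    (ex_CRInt_gen F (at_right 0) (at_left (PI / 2)%R) /\
     M_beta kappa mu alpha beta x y rho
       = 2 * CRInt_gen F (at_right 0) (at_left (PI / 2)%R)) /\
    (ex_CRInt_gen G (at_right 0) (Rbar_locally p_infty) /\
     M_beta kappa mu alpha beta x y rho
       = CRInt_gen G (at_right 0) (Rbar_locally p_infty)).
Proof.
  intros kappa mu alpha beta x y rho _ _ _ _ _ _ [Hser Hint] F G.
  pose proof (continuous_M_beta_integrand _ _ _ _ x y _ Hser) as Hcont.
  assert (HI : @is_RInt_gen C_R_NormedModule (M_beta_integrand kappa mu alpha beta x y rho)
      (at_right 0) (at_left 1) (M_beta kappa mu alpha beta x y rho))
    by exact (RInt_gen_correct (V := C_R_CompleteNormedModule) _ Hint).
  set (I := M_beta kappa mu alpha beta x y rho) in *.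
  assert (HPI : (0 < PI / 2)%R) by (generalize PI_RGT_0; lra).
  assert (HF : @is_RInt_gen C_R_NormedModule F (at_right 0) (at_left (PI / 2)) (I / 2)).
  (* [cos theta ^ 2] runs from [1] down to [0], so the ends are swapped first and the value becomes
     [opp I]. *)
  { apply is_RInt_gen_swap in HI; try apply filter_filter.
    apply (is_RInt_gen_comp (V := C_R_CompleteNormedModule) _ _
      (at_right 0) (at_left (PI / 2)) _ (fun theta => cos theta ^ 2)%R
      (fun theta => -2 * (cos theta * sin theta))%R (fun theta => 0 < theta < PI / 2)%R) in HI.
    (* The factor [- / 2] cancels the constant [-2] of the Jacobian and turns [opp I] into
       [I / 2]. *)
    - apply (is_RInt_gen_scal _ (- / 2)) in HI.
      replace (I / 2) with (@scal R_AbsRing C_R_NormedModule (- / 2)%R (opp I)).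
      + refine (is_RInt_gen_ext _ _ _ _ HI).
        (* Agreement is needed only between ends lying in (0, PI / 2), where both bases of the
           powers are positive. *)
        apply Filter_prod with (fun t => 0 < t < PI / 2)%R (fun t => 0 < t < PI / 2)%R;
          [now apply at_right_lt | now apply at_left_gt |].
        intros a b Ha Hb t Ht; simpl in Ht.
        assert (Ht' : (0 < t < PI / 2)%R) by (apply (between_interval _ _ a b); lra).
        destruct (cos_sin_pos t Ht') as [Hc Hs].
        unfold F; rewrite <- (M_beta_integrand_cos2 kappa mu alpha beta x y rho t) by lra.
        rewrite scal_assoc; rewrite scal_C_R; f_equal; f_equal.
        unfold mult; simpl; field.
      + rewrite scal_C_R; change (RtoC (- / 2) * - I = I / 2).
        unfold Cdiv; rewrite <- RtoC_inv, RtoC_opp by lra; ring.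
    - intros a b t; apply between_interval.
    - intros t Ht; destruct (cos_sin_pos t Ht); apply Hcont; nra.
    - intros t _; split; [auto_derive; [auto | simpl; ring]|].
      apply (ex_derive_continuous (V := R_NormedModule)); auto_derive; auto.
    - now apply at_right_lt.
    - now apply at_left_gt.
    (* At [0] the squared cosine tends to [1] from below; the next bullet treats [PI / 2], where it
       tends to [0] from above. *)
    - apply (filterlim_within (at_right 0)).
      + replace 1%R with (cos 0 ^ 2)%R by (rewrite cos_0; ring).
        apply (continuous_at_right (fun t => cos t ^ 2)%R).
        apply (ex_derive_continuous (V := R_NormedModule)); auto_derive; auto.
      + refine (filter_imp _ _ _ (at_right_lt _ _ HPI)).
        intros t Ht; destruct (cos_sin_pos t Ht); nra.
    - apply (filterlim_within (at_left (PI / 2))).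
      + replace 0%R with (cos (PI / 2) ^ 2)%R by (rewrite cos_PI2; ring).
        apply (continuous_at_left (fun t => cos t ^ 2)%R).
        apply (ex_derive_continuous (V := R_NormedModule)); auto_derive; auto.
      + refine (filter_imp _ _ _ (at_left_gt _ _ HPI)).
        intros t Ht; destruct (cos_sin_pos t Ht); nra. }
  assert (Hratio : forall u, (0 < u -> 0 < u / (1 + u) < 1)%R).
  { intros u Hu; assert (Hi : (0 < / (1 + u))%R) by (apply Rinv_0_lt_compat; lra).
    replace (u / (1 + u))%R with (1 - / (1 + u))%R at 2 by (field; lra).
    split; [apply Rmult_lt_0_compat|]; lra. }
  assert (HG : @is_RInt_gen C_R_NormedModule G (at_right 0) (Rbar_locally p_infty) I).
  (* [u / (1 + u)] is increasing from [0] to [1], so the ends correspond in order without a swap. *)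
  { apply (is_RInt_gen_comp (V := C_R_CompleteNormedModule) _ _
      (at_right 0) (Rbar_locally p_infty) _ (fun u => u / (1 + u))%R
      (fun u => / (1 + u) ^ 2)%R (fun u => 0 < u)%R) in HI.
    - refine (is_RInt_gen_ext _ _ _ _ HI).
      apply Filter_prod with (fun u => 0 < u)%R (fun u => 0 < u)%R.
      + refine (filter_imp _ _ _ (at_right_lt 0 1 Rlt_0_1)); intros u Hu; lra.
      + exists 0%R; auto.
      + intros a b Ha Hb u Hu; simpl in Hu.
        rewrite scal_C_R; apply M_beta_integrand_ratio.
        apply Rlt_trans with (2 := proj1 Hu); now apply Rmin_glb_lt.
    - intros a b u Ha Hb Hu.
      apply Rlt_le_trans with (2 := proj1 Hu); now apply Rmin_glb_lt.
    - intros u Hu; apply Hcont, Hratio, Hu.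
    - intros u Hu; split; [auto_derive; [lra | field; lra]|].
      apply (ex_derive_continuous (V := R_NormedModule)); auto_derive.
      repeat split; auto; nra.
    - refine (filter_imp _ _ _ (at_right_lt 0 1 Rlt_0_1)); intros u Hu; lra.
    - exists 0%R; auto.
    - apply (filterlim_within (at_right 0)).
      + replace 0%R with (0 / (1 + 0))%R at 2 by field.
        apply (continuous_at_right (fun u => u / (1 + u))%R).
        apply (ex_derive_continuous (V := R_NormedModule)); auto_derive; lra.
      + refine (filter_imp _ _ _ (at_right_lt 0 1 Rlt_0_1)).
        intros u Hu; now apply Hratio.
    - apply (filterlim_within (Rbar_locally p_infty)).
      + apply filterlim_locally; intros eps.
        (* The distance to [1] is [1 / (1 + u)], which is below [eps] once [u > 1 / eps]. *)
        exists (/ eps)%R; intros u Hu.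
        pose proof (cond_pos eps) as He.
        pose proof (Rinv_0_lt_compat _ He) as Hie.
        change (Rabs (u / (1 + u) - 1) < eps)%R.
        replace (u / (1 + u) - 1)%R with (- / (1 + u))%R by (field; lra).
        rewrite Rabs_Ropp, Rabs_pos_eq by (left; apply Rinv_0_lt_compat; lra).
        rewrite <- (Rinv_inv eps); apply Rinv_lt_contravar; nra.
      + exists 0%R; intros u Hu; now apply Hratio. }
  split; split.
  - now exists (I / 2).
  - replace (CRInt_gen F (at_right 0) (at_left (PI / 2))) with (I / 2).
    + field; apply RtoC_neq_0; lra.
    + symmetry; exact (is_RInt_gen_unique (V := C_R_CompleteNormedModule) _ _ HF).
  - now exists I.
  - symmetry; exact (is_RInt_gen_unique (V := C_R_CompleteNormedModule) _ _ HG).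
Qed.
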